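(* Let $n,p$ be positive integers and, for all $k\ge0$, let $\phi_k\in\mathbb{R}^{p\times n}$ and $y_k\in\mathbb{R}^p$. Let $R\in\mathbb{R}^{n\times n}$ be positive definite, let $\lambda\in(0,1]$ and $\varepsilon>0$, let $P_0=R^{-1}$, and, for all $k\ge0$, let $P_{k+1}$ be given by $$P_{k+1}^{-1}=\Lambda_kP_k^{-1}\Lambda_k+\phi_k^{\mathrm T}\phi_k,$$ where $\Lambda_k$ is the variable-direction forgetting matrix determined by $P_k,\phi_k,\lambda,\varepsilon$ (defined in the context). Let $\theta_0\in\mathbb{R}^n$, and, for all $k\ge0$ and $\hat\theta\in\mathbb{R}^n$, define $$J_k(\hat\theta)=\sum_{i=0}^k(y_i-\phi_i\hat\theta)^{\mathrm T}(y_i-\phi_i\hat\theta)+(\hat\theta-\theta_0)^{\mathrm T}R_k(\hat\theta-\theta_0),$$ where $R_{-1}=R$ and, for all $k\ge0$, $$R_k=R_{k-1}+\Lambda_kP_k^{-1}\Lambda_k-P_k^{-1}.$$ Then, for all $k\ge0$, $J_k$ has a unique global minimizer $\theta_{k+1}=\operatorname{argmin}_{\hat\theta\in\mathbb{R}^n}J_k(\hat\theta)$, which is given by $$\theta_{k+1}=\theta_k+P_{k+1}\phi_k^{\mathrm T}(y_k-\phi_k\theta_k)+P_{k+1}(R_k-R_{k-1})(\theta_0-\theta_k).$$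
   Context: Positive definite matrices are real symmetric. Variable-direction forgetting matrix: for each $k\ge0$, given the positive definite matrix $P_k\in\mathbb{R}^{n\times n}$, let $P_k^{-1}=U_k\Sigma_kU_k^{\mathrm T}$ be a singular value decomposition, where $U_k\in\mathbb{R}^{n\times n}$ is an orthogonal matrix whose columns are singular vectors of $P_k^{-1}$ and $\Sigma_k$ is the diagonal matrix of corresponding singular values. Set $\psi_k=\phi_kU_k\in\mathbb{R}^{p\times n}$, and let $\overline\Lambda_k\in\mathbb{R}^{n\times n}$ be the diagonal matrix with $\overline\Lambda_k(i,i)=\sqrt\lambda$ if $\|\mathrm{col}_i(\psi_k)\|>\varepsilon$ and $\overline\Lambda_k(i,i)=1$ otherwise, where $\mathrm{col}_i(\psi_k)$ is the $i$th column of $\psi_k$ and $\|\cdot\|$ is the Euclidean norm. Then $\Lambda_k=U_k\overline\Lambda_kU_k^{\mathrm T}$. *)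

(* Defs.v *)
From mathcomp Require Import all_boot all_order all_algebra.
From mathcomp Require Import reals.
Set Implicit Arguments.
Unset Strict Implicit.
Unset Printing Implicit Defensive.
Import Order.TTheory GRing.Theory Num.Theory.
Local Open Scope ring_scope.

Section VariableDirectionForgetting.
Variable F : realType.

Definition posdefmx n (A : 'M[F]_n) : Prop :=
  A^T = A /\ forall x : 'cV[F]_n, x != 0 -> 0 < (x^T *m A *m x) 0 0.

Definition orthogonal_mx n (U : 'M[F]_n) : Prop := U^T *m U = 1%:M.

(* The singular values need not be sorted. *)
Definition is_svd n (A U S V : 'M[F]_n) : Prop :=
  [/\ orthogonal_mx U, orthogonal_mx V,
      is_diag_mx S, forall i, 0 <= S i i & A = U *m S *m V^T].

(* The norm `|v| of mathcomp-analysis on matrices is the max norm. *)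
Definition enorm p (v : 'cV[F]_p) : F := Num.sqrt (\sum_(i < p) v i 0 ^+ 2).

Definition forgetting_diag n p (lambda eps : F) (psi : 'M[F]_(p, n)) :
    'M[F]_n :=
  diag_mx (\row_(i < n)
    if eps < enorm (col i psi) then Num.sqrt lambda else 1).

(* A singular value decomposition is not unique, so the forgetting matrix is
   a relation: it holds of every matrix obtained from some decomposition. *)
Definition is_vdf_matrix n p (lambda eps : F) (P : 'M[F]_n)
    (phi : 'M[F]_(p, n)) (Lam : 'M[F]_n) : Prop :=
  exists U S : 'M[F]_n,
    is_svd (invmx P) U S U /\
    Lam = U *m forgetting_diag lambda eps (phi *m U) *m U^T.

(* Indices are shifted by one: reg_mx R P Lam k is R_(k-1), so that
   reg_mx R P Lam 0 is R_(-1) = R. *)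
Fixpoint reg_mx n (R : 'M[F]_n) (P Lam : nat -> 'M[F]_n) (k : nat) :
    'M[F]_n :=
  if k is j.+1 then
    reg_mx R P Lam j + Lam j *m invmx (P j) *m Lam j - invmx (P j)
  else R.

Definition vdf_cost n p (phi : nat -> 'M[F]_(p, n)) (y : nat -> 'cV[F]_p)
    (R : 'M[F]_n) (P Lam : nat -> 'M[F]_n) (theta0 : 'cV[F]_n) (k : nat)
    (th : 'cV[F]_n) : F :=
  \sum_(i < k.+1)
     ((y i - phi i *m th)^T *m (y i - phi i *m th)) 0 0
  + ((th - theta0)^T *m reg_mx R P Lam k.+1 *m (th - theta0)) 0 0.

Definition global_minimizer (T : Type) (J : T -> F) (x : T) : Prop :=
  forall z, J x <= J z.

End VariableDirectionForgetting.

(* Main.v *)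
Require Import Defs.
From mathcomp Require Import all_boot all_order all_algebra.
From mathcomp Require Import reals ring.
Set Implicit Arguments.
Unset Strict Implicit.
Unset Printing Implicit Defensive.
Import Order.TTheory GRing.Theory Num.Theory.
Local Open Scope ring_scope.

(** Write Q_k for the information matrix [invmx (P k)].  Unrolling its recursion
    against that of the regularization weights gives
    Q_k = R_(k-1) + \sum_(i < k) phi_i^T phi_i  ([information_decomposition]),
    so Q_(k+1) is exactly half the Hessian of the cost J_k.  Forgetting is
    a congruence by an invertible symmetric matrix, which preserves positive
    definiteness, and the new data add a positive semidefinite term; hence every Q_k is positive
    definite ([posdef_information]).  Each cost J_k is therefore a strictly convex
    quadratic whose unique minimizer is the solution theta of the normal equations
    Q_(k+1) theta = R_k theta_0 + \sum_(i <= k) phi_i^T y_i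
    ([regularized_least_squares]).

    It remains to see that the recursive update solves these equations.
    Multiplying it by Q_(k+1) = Q_k + (R_k - R_(k-1)) + phi_k^T phi_k cancels
    every term containing theta_k except Q_k theta_k, which turns the normal
    equations at time k into those at time k + 1 ([normal_equations]). *)

Section PositiveDefinite.
Variable F : realType.

Lemma sqnormE p (v : 'cV[F]_p) : (v^T *m v) 0 0 = \sum_i v i 0 ^+ 2.
Proof. by rewrite mxE; apply: eq_bigr => i _; rewrite mxE expr2. Qed.

Lemma sqnorm_ge0 p (v : 'cV[F]_p) : 0 <= (v^T *m v) 0 0.
Proof. by rewrite sqnormE; apply: sumr_ge0 => i _; apply: sqr_ge0. Qed.

Lemma bilinear_trmx n (A : 'M[F]_n) (u v : 'cV[F]_n) :
  (u^T *m A *m v) 0 0 = (v^T *m A^T *m u) 0 0.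
Proof.
have -> : v^T *m A^T *m u = (u^T *m A *m v)^T.
  by rewrite !trmx_mul trmxK mulmxA.
by rewrite [RHS]mxE.
Qed.

Lemma posdef_unit n (A : 'M[F]_n) : posdefmx A -> A \in unitmx.
Proof.
move=> [_ A_gt0]; rewrite unitmxE unitfE; apply/negP => /det0P [v v_neq0 vA].
have vT_neq0 : v^T != 0 by rewrite -trmx0 (inj_eq trmx_inj).
by have := A_gt0 _ vT_neq0; rewrite trmxK vA mul0mx mxE ltxx.
Qed.

Lemma posdef_congr n (A L : 'M[F]_n) :
  posdefmx A -> L \in unitmx -> posdefmx (L^T *m A *m L).
Proof.
move=> [A_sym A_gt0] L_unit; split; first by rewrite !trmx_mul trmxK A_sym mulmxA.
move=> x x_neq0.
have -> : x^T *m (L^T *m A *m L) *m x = (L *m x)^T *m A *m (L *m x).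
  by rewrite trmx_mul !mulmxA.
apply: A_gt0; apply: contra x_neq0 => /eqP Lx0.
by rewrite -[x](mulKmx L_unit) Lx0 mulmx0.
Qed.

Lemma posdef_addGram n p (A : 'M[F]_n) (B : 'M[F]_(p, n)) :
  posdefmx A -> posdefmx (A + B^T *m B).
Proof.
move=> [A_sym A_gt0]; split; first by rewrite linearD /= trmx_mul trmxK A_sym.
move=> x x_neq0; rewrite mulmxDr mulmxDl mxE ltr_pwDl ?A_gt0 //.
have -> : x^T *m (B^T *m B) *m x = (B *m x)^T *m (B *m x).
  by rewrite trmx_mul !mulmxA.
exact: sqnorm_ge0.
Qed.

End PositiveDefinite.

Section RegularizedLeastSquares.
Variable F : realType.

Lemma quadratic_formD n (A : 'M[F]_n) (x d : 'cV[F]_n) : A^T = A ->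
  ((x + d)^T *m A *m (x + d)) 0 0 =
  (x^T *m A *m x) 0 0 + (d^T *m (A *m x)) 0 0 *+ 2 + (d^T *m A *m d) 0 0.
Proof.
have entryD (M N : 'M[F]_1) : (M + N) 0 0 = M 0 0 + N 0 0 by rewrite mxE.
move=> A_sym; have cross := bilinear_trmx A x d; rewrite A_sym in cross.
rewrite [(x + d)^T]linearD /= !(mulmxDl, mulmxDr) !entryD cross mulmxA mulr2n.
by rewrite !addrA.
Qed.

Lemma sqnorm_residualD n p (B : 'M[F]_(p, n)) (b : 'cV[F]_p) (x d : 'cV[F]_n) :
  ((b - B *m (x + d))^T *m (b - B *m (x + d))) 0 0 =
  ((b - B *m x)^T *m (b - B *m x)) 0 0
  - (d^T *m (B^T *m (b - B *m x))) 0 0 *+ 2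
  + (d^T *m (B^T *m B) *m d) 0 0.
Proof.
have := quadratic_formD (b - B *m x) (- (B *m d)) (trmx1 F p).
rewrite !mul1mx !mulmx1 -addrA -opprD -mulmxDr => ->.
rewrite linearN /= mulNmx mulNmx mulmxN opprK trmx_mul !mulmxA.
by rewrite [(- _ : 'M_1) 0 0]mxE mulNrn.
Qed.

(** Completing the square around a solution x of the normal equations: the part
    of the cost linear in z - x has the residual of these equations as its
    coefficient, hence vanishes, and the cost exceeds its value at x by the
    Q-form of z - x.  Positive definiteness is asked of Q because the weight A
    stands for R_k, which may fail to be positive definite after
    forgetting. *)
Lemma regularized_least_squares n p m (A Q : 'M[F]_n) (B : nat -> 'M[F]_(p, n))
    (b : nat -> 'cV[F]_p) (x0 x : 'cV[F]_n) :
    posdefmx Q -> Q = A + \sum_(i < m) (B i)^T *m B i ->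
    Q *m x = A *m x0 + \sum_(i < m) (B i)^T *m b i ->
  unique (global_minimizer (fun z : 'cV[F]_n =>
    \sum_(i < m) ((b i - B i *m z)^T *m (b i - B i *m z)) 0 0
    + ((z - x0)^T *m A *m (z - x0)) 0 0)) x.
Proof.
move=> [Q_sym Q_gt0] QE normal; set J := fun z => _.
have A_sym : A^T = A.
  have -> : A = Q - \sum_(i < m) (B i)^T *m B i by rewrite QE addrK.
  rewrite linearB /= Q_sym linear_sum /=; congr (_ - _).
  by apply: eq_bigr => i _; rewrite trmx_mul trmxK.
have gradient0 : A *m (x - x0) = \sum_(i < m) (B i)^T *m (b i - B i *m x).
  under eq_bigr do rewrite mulmxBr mulmxA.
  rewrite sumrB -mulmx_suml mulmxBr; apply/eqP.
  rewrite subr_eq addrAC [_ + A *m x0]addrC -normal QE mulmxDl.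
  by rewrite addrK.
have JD (d : 'cV_n) : J (x + d) = J x + (d^T *m Q *m d) 0 0.
  rewrite /J [x + d - x0]addrAC (quadratic_formD (x - x0) d A_sym) gradient0.
  under eq_bigr do rewrite sqnorm_residualD.
  rewrite QE (mulmxDr d^T) (mulmxDl _ _ d) [(_ + _ : 'M_1) 0 0]mxE.
  rewrite big_split sumrB /= !mulmx_sumr mulmx_suml !summxE -sumrMnl; ring.
split=> [z|x' x'_min].
  rewrite -(subrK x z) addrC JD lerDl.
  have [->|d_neq0] := eqVneq (z - x) 0; first by rewrite mulmx0 mxE.
  exact/ltW/Q_gt0.
apply/eqP; rewrite eq_sym -subr_eq0; apply/negPn/negP => /Q_gt0; apply/negP.
by rewrite -leNgt -(lerD2l (J x)) addr0 -JD addrC subrK.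
Qed.

End RegularizedLeastSquares.

Section Forgetting.
Variables (F : realType) (n p : nat).

(** The eigenvalues of a forgetting matrix are among 1 and the square root of
    lambda, all nonzero. *)
Lemma vdf_sym_unit (lambda eps : F) (P Lam : 'M[F]_n) (phi : 'M[F]_(p, n)) :
    0 < lambda -> is_vdf_matrix lambda eps P phi Lam ->
  Lam^T = Lam /\ Lam \in unitmx.
Proof.
move=> lambda_gt0 [U [S [[U_orth _ _ _ _] ->]]].
split; first by rewrite !trmx_mul trmxK tr_diag_mx mulmxA.
have [UT_unit U_unit] := mulmx1_unit U_orth.
rewrite !unitmx_mul U_unit UT_unit andbT /=.
rewrite unitmxE unitfE det_diag; apply/prodf_neq0 => i _; rewrite mxE.
by case: ifP => _; rewrite ?oner_neq0 // sqrtr_eq0 -ltNge.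
Qed.

Variables (phi : nat -> 'M[F]_(p, n)) (y : nat -> 'cV[F]_p) (R : 'M[F]_n).
Variables (lambda eps : F) (P Lam : nat -> 'M[F]_n).
Hypothesis R_pd : posdefmx R.
Hypothesis lambda_gt0 : 0 < lambda.
Hypothesis P_0 : P 0%N = invmx R.
Hypothesis Lam_vdf : forall k, is_vdf_matrix lambda eps (P k) (phi k) (Lam k).
Hypothesis P_S : forall k, invmx (P k.+1) =
  Lam k *m invmx (P k) *m Lam k + (phi k)^T *m phi k.

Lemma posdef_information k : posdefmx (invmx (P k)).
Proof.
elim: k => [|k IHk]; first by rewrite P_0 invmxK.
have [Lam_sym Lam_unit] := vdf_sym_unit lambda_gt0 (Lam_vdf k).
by rewrite P_S -{1}Lam_sym; apply/posdef_addGram/posdef_congr.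
Qed.

Lemma mul_information k : P k *m invmx (P k) = 1%:M.
Proof. by rewrite mulmxV // -unitmx_inv; apply/posdef_unit/posdef_information. Qed.

Lemma information_step k : invmx (P k.+1) =
  invmx (P k) + (reg_mx R P Lam k.+1 - reg_mx R P Lam k) + (phi k)^T *m phi k.
Proof.
rewrite P_S /=; congr (_ + _).
set r := reg_mx R P Lam k.
by rewrite -[r + _ - _]addrA [r + _]addrC addrK subrKC.
Qed.

Lemma information_decomposition k :
  invmx (P k) = reg_mx R P Lam k + \sum_(i < k) (phi i)^T *m phi i.
Proof.
elim: k => [|k IHk]; first by rewrite big_ord0 addr0 P_0 invmxK.
rewrite information_step big_ord_recr /= IHk [RHS]addrA; congr (_ + _).
by rewrite addrAC subrKC.
Qed.

Variable theta0 : 'cV[F]_n.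

Fixpoint vdf_estimate (k : nat) : 'cV[F]_n :=
  if k is j.+1 then
    vdf_estimate j + P k *m (phi j)^T *m (y j - phi j *m vdf_estimate j)
    + P k *m (reg_mx R P Lam k - reg_mx R P Lam j) *m (theta0 - vdf_estimate j)
  else theta0.

Lemma normal_equations k :
  invmx (P k) *m vdf_estimate k =
  reg_mx R P Lam k *m theta0 + \sum_(i < k) (phi i)^T *m y i.
Proof.
elim: k => [|k IHk]; first by rewrite big_ord0 addr0 P_0 invmxK.
have QP : invmx (P k.+1) *m P k.+1 = 1%:M by apply/mulmx1C/mul_information.
(* An opaque name keeps the increment of R_k from being unfolded by [/=]. *)
have [D DE] : {D | D = reg_mx R P Lam k.+1 - reg_mx R P Lam k} by eexists.
have RS : reg_mx R P Lam k.+1 = reg_mx R P Lam k + D by rewrite DE subrKC.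
have update : vdf_estimate k.+1 = vdf_estimate k + P k.+1 *m
    ((phi k)^T *m (y k - phi k *m vdf_estimate k) + D *m (theta0 - vdf_estimate k)).
  by rewrite DE mulmxDr !mulmxA addrA.
rewrite update (mulmxDr (invmx _)) (mulmxA (invmx (P k.+1))) QP mul1mx.
rewrite information_step -DE RS big_ord_recr /=.
rewrite !(mulmxDl, mulmxBr) IHk mulmxA.
(* Both sides are now sums of the same column vectors; the terms in theta_k
   coming from D and phi_k^T phi_k cancel. *)
move: (D *m theta0) (D *m _) (_ *m theta0) (\sum_(i < k) _) => a1 a2 a3 a4.
move: (_ *m phi k *m _) (_ *m y k) => a5 a6.
by apply/matrixP => i j; rewrite !mxE; ring.
Qed.

End Forgetting.

Theorem theoremS1 (F : realType) (n p : nat) (n_gt0 : (0 < n)%N)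
    (p_gt0 : (0 < p)%N)
    (phi : nat -> 'M[F]_(p, n)) (y : nat -> 'cV[F]_p)
    (R : 'M[F]_n) (R_pd : posdefmx R)
    (lambda eps : F) (lambda_gt0 : 0 < lambda) (lambda_le1 : lambda <= 1)
    (eps_gt0 : 0 < eps)
    (P Lam : nat -> 'M[F]_n)
    (P_0 : P 0%N = invmx R)
    (Lam_vdf : forall k, is_vdf_matrix lambda eps (P k) (phi k) (Lam k))
    (P_S : forall k, invmx (P k.+1) =
       Lam k *m invmx (P k) *m Lam k + (phi k)^T *m phi k)
    (theta0 : 'cV[F]_n) :
  exists theta : nat -> 'cV[F]_n,
    theta 0%N = theta0 /\
    forall k : nat,
      unique (global_minimizer (vdf_cost phi y R P Lam theta0 k))
        (theta k.+1) /\
      theta k.+1 =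
        theta k + P k.+1 *m (phi k)^T *m (y k - phi k *m theta k)
        + P k.+1 *m (reg_mx R P Lam k.+1 - reg_mx R P Lam k)
            *m (theta0 - theta k).
Proof.
exists (vdf_estimate phi y R P Lam theta0); split=> // k; split=> //.
apply: regularized_least_squares.
- exact: (posdef_information R_pd lambda_gt0 P_0 Lam_vdf P_S k.+1).
- exact: (information_decomposition P_0 P_S).
- exact: (normal_equations y R_pd lambda_gt0 P_0 Lam_vdf P_S).
Qed.
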